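(* Let $I\subseteq\mathbb{R}$ be an interval, let $h:J\to\mathbb{R}$ be a nonnegative superadditive function with $[0,1]\subseteq J\subseteq\mathbb{R}$, and let $f,g\in SX(h,I)$. Let $a,b\in I$ with $a<b$. Then $$\left[f\left(\frac{a+b}{2}\right)\frac{g(a)+g(b)}{2}+g\left(\frac{a+b}{2}\right)\frac{f(a)+f(b)}{2}\right]\left[\int_0^1 h(\alpha)\,d\alpha+\int_0^1 h(1-\alpha)\,d\alpha\right]$$ $$\le f\left(\frac{a+b}{2}\right)g\left(\frac{a+b}{2}\right)+h(1)^2\bigl(M(a,b)+N(a,b)\bigr).$$
   Context: $SX(h,I)$ denotes the class of $h$-convex functions: $f:I\to\mathbb{R}$ belongs to $SX(h,I)$ if $f$ is nonnegative and $f(tx+(1-t)y)\le h(t)f(x)+h(1-t)f(y)$ for all $x,y\in I$ and $t\in[0,1]$. The function $h:J\to\mathbb{R}$ is superadditive if $h(x+y)\ge h(x)+h(y)$ for all $x,y\in J$ (with $x+y\in J$). Notation: $M(a,b)=f(a)g(a)+f(b)g(b)$ and $N(a,b)=f(a)g(b)+f(b)g(a)$. *)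

(* Defs.v *)
From HB Require Import structures.
From mathcomp Require Import all_boot all_order all_algebra.
From mathcomp Require Import all_classical all_reals all_analysis.

Set Implicit Arguments.
Unset Strict Implicit.
Unset Printing Implicit Defensive.

Import Order.TTheory GRing.Theory Num.Theory.
Import numFieldNormedType.Exports.

Local Open Scope classical_set_scope.
Local Open Scope ring_scope.

(* Functions on I or J are total functions R -> R, constrained on I or J only.
   For h : J -> R, h t and h (1 - t) are meaningful here when `[0, 1] `<=` J. *)
Definition SX (R : realType) (h : R -> R) (I : set R) : set (R -> R) :=
  [set f | (forall x, I x -> 0 <= f x) /\
           (forall x y t, I x -> I y -> 0 <= t <= 1 ->
              f (t * x + (1 - t) * y) <= h t * f x + h (1 - t) * f y)].

(* If also 0 <= h on J and `[0, 1] `<=` J, then h is nondecreasing and bounded on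
   `[0, 1], hence integrable there. *)
Definition superadditive_on (R : realType) (J : set R) (h : R -> R) : Prop :=
  forall x y, J x -> J y -> J (x + y) -> h x + h y <= h (x + y).

Definition Mab (R : realType) (f g : R -> R) (a b : R) : R :=
  f a * g a + f b * g b.

Definition Nab (R : realType) (f g : R -> R) (a b : R) : R :=
  f a * g b + f b * g a.

(* Main.v *)
Require Import Defs.
From HB Require Import structures.
From mathcomp Require Import all_boot all_order all_algebra.
From mathcomp Require Import all_classical all_reals all_analysis.
From mathcomp Require Import measurable_realfun ring lra.

(** The integral factor is at most [h 1]: for [t] in [[0, 1]] superadditivity
    gives [h t + h (1 - t) <= h 1], and integrating over [[0, 1]] gives
    [Rintegral_superadditive_le].  Splitting the integral of the sum requires
    integrability; a nonnegative superadditive function is nondecreasing, hence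
    measurable and bounded on [[0, 1]].

    At the midpoint, [h]-convexity gives [f m <= h (1/2) * (f a + f b)], and
    [2 * h (1/2) <= h 1] turns this into [f m <= p / 2] with
    [p = h 1 * (f a + f b)] ([SX_midpoint_le]); likewise [g m <= q / 2] with
    [q = h 1 * (g a + g b)].  So the left-hand side is at most
    [(f m * q + g m * p) / 2 <= p * q / 2], while
    [p * q = h 1 ^+ 2 * (M(a, b) + N(a, b))] is nonnegative, and so is [f m * g m],
    so that the right-hand side is at least [p * q]. *)

Import Order.TTheory GRing.Theory Num.Theory.
Import numFieldNormedType.Exports.

Local Open Scope classical_set_scope.
Local Open Scope ring_scope.

Lemma nondecreasing_in_measurable (R : realType) (D : set R) (f : R -> R) :
  is_interval D -> {in D &, nondecreasing_fun f} -> measurable_fun D f.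
Proof.
move=> iD f_nd; apply: (measurability (@RGenCInfty.G R)) => [|/= _ [_] [r] -> <-].
  exact: RGenCInfty.measurableE.
(* the part of [D] on which [f] takes values at least [r] is an interval *)
apply: is_interval_measurable => s t/= [Ds +] [Dt _] u /andP[su ut].
rewrite /= in_itv/= andbT => fs.
have Du : D u by apply: (iD s t) => //; rewrite su ut.
by split=> //=; rewrite in_itv/= andbT (le_trans fs)// f_nd ?inE.
Qed.

Section superadditive.
Variables (R : realType) (J : set R) (h : R -> R).
Hypotheses (J01 : `[0, 1] `<=` J) (h_ge0 : forall x, J x -> 0 <= h x).
Hypothesis h_superadd : superadditive_on J h.

(** Because [h y - h x] is at least [h (y - x)], which is nonnegative. *)
Lemma superadditive_nondecreasing : {in `[0, 1] &, nondecreasing_fun h}.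
Proof.
move=> x y; rewrite !in_itv/= => /andP[x0 x1] /andP[y0 y1] xy.
have Jx : J x by apply: J01; rewrite /= in_itv/=; lra.
have Jy : J y by apply: J01; rewrite /= in_itv/=; lra.
have Jyx : J (y - x) by apply: J01; rewrite /= in_itv/=; lra.
have := h_superadd _ _ Jx Jyx; rewrite subrKC => /(_ Jy).
have := h_ge0 _ Jyx; lra.
Qed.

Lemma superadditive_compl_le t : 0 <= t <= 1 -> h t + h (1 - t) <= h 1.
Proof.
move=> /andP[t0 t1].
have := @h_superadd t (1 - t); rewrite subrKC; apply.
all: by apply: J01; rewrite /= in_itv/=; lra.
Qed.

Lemma superadditive_bounds t : 0 <= t <= 1 -> 0 <= h t <= h 1.
Proof.
move=> t01.
have Jt : J t by apply: J01; rewrite /= in_itv.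
have Jt' : J (1 - t) by apply: J01; rewrite /= in_itv/=; lra.
have := superadditive_compl_le _ t01; have := h_ge0 _ Jt; have := h_ge0 _ Jt'; lra.
Qed.

Local Notation mu := (@lebesgue_measure R).

Let integrable01 (k : R -> R) : measurable_fun (`[0, 1] : set R) k ->
  (forall t, 0 <= t <= 1 -> 0 <= k t <= h 1) ->
  mu.-integrable (`[0, 1] : set R) (EFin \o k).
Proof.
move=> mk k_bd; apply: measurable_bounded_integrable => //.
  by rewrite /= lebesgue_measure_itv/= lte_fin ltr01 oppr0 adde0 ltry.
exists (h 1); split; first exact: num_real.
move=> M hM t /=; rewrite in_itv/= => /k_bd /andP[k0 k1].
by rewrite ger0_norm// (le_trans k1)// ltW.
Qed.

Lemma superadditive_integrable : mu.-integrable (`[0, 1] : set R) (EFin \o h).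
Proof.
apply: integrable01 superadditive_bounds.
apply: nondecreasing_in_measurable; first exact: interval_is_interval.
by move=> x y; rewrite !inE; exact: superadditive_nondecreasing.
Qed.

Lemma superadditive_compl_integrable :
  mu.-integrable (`[0, 1] : set R) (EFin \o (fun t => h (1 - t))).
Proof.
apply: integrable01 => [|t t01]; last by apply: superadditive_bounds; lra.
(* [h (1 - t)] is nonincreasing in [t], so its opposite is nondecreasing *)
rewrite -[X in measurable_fun _ X]opprK; apply/measurable_funN.
apply: nondecreasing_in_measurable; first exact: interval_is_interval.
move=> x y; rewrite !inE/= !in_itv/= => x01 y01 xy.
by rewrite lerN2 superadditive_nondecreasing ?in_itv/=; lra.
Qed.

Lemma Rintegral_superadditive_le :
  (\int[mu]_(t in `[0, 1]) h t) + (\int[mu]_(t in `[0, 1]) h (1 - t)) <= h 1.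
Proof.
have ih := superadditive_integrable; have ih' := superadditive_compl_integrable.
rewrite -RintegralD//.
have -> : h 1 = \int[mu]_(t in `[0, 1]) h 1.
  rewrite Rintegral_cst//= lebesgue_measure_itv/= lte_fin ltr01.
  by rewrite oppr0 adde0 mulr1.
apply: le_Rintegral => //.
- exact: (integrableD _ ih ih').
- apply: integrable01 => // t _.
  by rewrite lexx andbT; apply/h_ge0/J01; rewrite /= in_itv/= ler01 lexx.
- by move=> t /=; rewrite in_itv/=; exact: superadditive_compl_le.
Qed.

(** The factor [1 / 2] comes from superadditivity, [2 * h (1/2) <= h 1]; the
    nonnegativity of [f a + f b] lets it pass through the product. *)
Lemma SX_midpoint_le (I : set R) (f : R -> R) (a b : R) : SX h I f ->
  I a -> I b -> f ((a + b) / 2) <= h 1 * (f a + f b) / 2.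
Proof.
move=> [f_ge0 f_cvx] Ia Ib.
have half : 1 - 2^-1 = 2^-1 :> R by lra.
have half01 : 0 <= (2^-1 : R) <= 1 by lra.
have := f_cvx a b 2^-1 Ia Ib half01; rewrite half -!mulrDr mulrC.
have := superadditive_compl_le _ half01; rewrite half.
have := f_ge0 _ Ia; have := f_ge0 _ Ib; nra.
Qed.

End superadditive.

Theorem theorem4 (R : realType) (I J : set R) (h f g : R -> R) (a b : R)
  (I_itv : is_interval I)
  (J01 : `[0, 1] `<=` J)
  (h_ge0 : forall x, J x -> 0 <= h x)
  (h_superadd : superadditive_on J h)
  (f_SX : SX h I f) (g_SX : SX h I g)
  (Ia : I a) (Ib : I b) (ab : a < b) :
  (f ((a + b) / 2) * ((g a + g b) / 2) + g ((a + b) / 2) * ((f a + f b) / 2)) *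
    ((\int[lebesgue_measure]_(t in `[0, 1]) h t) +
     (\int[lebesgue_measure]_(t in `[0, 1]) h (1 - t)))
  <= f ((a + b) / 2) * g ((a + b) / 2) +
     h 1 ^+ 2 * (Mab f g a b + Nab f g a b).
Proof.
have fm := SX_midpoint_le _ _ _ J01 h_superadd _ _ _ _ f_SX Ia Ib.
have gm := SX_midpoint_le _ _ _ J01 h_superadd _ _ _ _ g_SX Ia Ib.
have int_le := Rintegral_superadditive_le _ _ _ J01 h_ge0 h_superadd.
have [f_ge0 _] := f_SX; have [g_ge0 _] := g_SX.
have Im : I ((a + b) / 2) by apply: (I_itv a b) => //; lra.
have h1_ge0 : 0 <= h 1 by apply/h_ge0/J01; rewrite /= in_itv/= ler01 lexx.
have fa0 := f_ge0 _ Ia; have fb0 := f_ge0 _ Ib; have fm0 := f_ge0 _ Im.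
have ga0 := g_ge0 _ Ia; have gb0 := g_ge0 _ Ib; have gm0 := g_ge0 _ Im.
rewrite /Mab /Nab.
set F := f ((a + b) / 2) in fm fm0 *; set G := g ((a + b) / 2) in gm gm0 *.
apply: (@le_trans _ _ ((F * ((g a + g b) / 2) + G * ((f a + f b) / 2)) * h 1)).
  by apply: ler_wpM2l int_le; nra.
set p := h 1 * (f a + f b) in fm *; set q := h 1 * (g a + g b) in gm *.
have p0 : 0 <= p by rewrite mulr_ge0// addr_ge0.
have q0 : 0 <= q by rewrite mulr_ge0// addr_ge0.
have -> : (F * ((g a + g b) / 2) + G * ((f a + f b) / 2)) * h 1 =
  (F * q + G * p) / 2 by rewrite /p /q; field.
have -> : h 1 ^+ 2 * (f a * g a + f b * g b + (f a * g b + f b * g a)) = p * q.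
  by rewrite /p /q; ring.
have Fq : F * q <= p / 2 * q by exact: ler_wpM2r.
have Gp : G * p <= q / 2 * p by exact: ler_wpM2r.
have FG0 : 0 <= F * G by exact: mulr_ge0.
have pq0 : 0 <= p * q by exact: mulr_ge0.
lra.
Qed.
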